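(* Let $\mu$ and $\nu$ be probability distributions on $\mathcal{X}\subseteq\mathbb{R}^d$, and let $\mathcal{P}\subseteq\{1,\dots,d\}$ be a set of protected attributes such that every $x\in\mathcal{X}$ satisfies $x_p\in\{0,1\}$ for all $p\in\mathcal{P}$. Let $x_1,\dots,x_{N_1}$ be independent samples from $\mu$ and $x'_1,\dots,x'_{N_2}$ independent samples from $\nu$ (the two samples independent of each other), and let $\hat\mu=\frac{1}{N_1}\sum_{i=1}^{N_1}\delta_{x_i}$ and $\hat\nu=\frac{1}{N_2}\sum_{i=1}^{N_2}\delta_{x'_i}$ be the empirical distributions. Fix $\delta>0$ and set $N=\min(N_1,N_2)$. Then with probability at least $1-2\delta$ over the samples, $$\mathrm{MSD}(\mu,\nu;\mathcal{P})\le \mathrm{MSD}(\hat\mu,\hat\nu;\mathcal{P})+4\sqrt{\frac{2|\mathcal{P}|+\log\frac{2}{\delta}}{2N}}.$$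
   Context: For $x\in\mathbb{R}^d$ and $p\in\mathcal{P}$, $x_p$ denotes the $p$-th coordinate and $\bar x_p:=1-x_p$. The set of literals is $\mathcal{L}=\{x\mapsto x_p,\ x\mapsto\bar x_p : p\in\mathcal{P}\}$. For a subset $S\subseteq\mathcal{L}$ (called a subgroup), the term $\chi_S:\mathbb{R}^d\to\{0,1\}$ is $\chi_S(x)=\prod_{s\in S}s(x)$ (the empty product being $1$). Let $\mathcal{S}$ denote the set of all subgroups $S\subseteq\mathcal{L}$. For a distribution $\mu$ and function $f$, $\mu(f)=\int f\,d\mu$. The Maximum Subgroup Discrepancy is $\mathrm{MSD}(\mu,\nu;\mathcal{P})=\sup_{S\in\mathcal{S}}|\mu(\chi_S)-\nu(\chi_S)|$. $\delta_x$ is the point mass at $x$, and $\log$ is the natural logarithm. *)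

(* Defs.v *)
From HB Require Import structures.
From mathcomp Require Import all_boot all_order all_algebra.
From mathcomp Require Import all_classical all_reals all_analysis.
Set Implicit Arguments. Unset Strict Implicit. Unset Printing Implicit Defensive.
Import Order.TTheory GRing.Theory Num.Theory.
Local Open Scope classical_set_scope.
Local Open Scope ring_scope.

(* Points of R^d are d-tuples of reals (product sigma-algebra, Borel on R).
   Coordinates are indexed by 'I_d (i.e. 0..d-1 instead of 1..d). *)

Definition literal_eval {R : realType} {d : nat} (l : 'I_d * bool)
  (x : d.-tuple R) : R :=
  if l.2 then tnth x l.1 else 1 - tnth x l.1.

Definition chi {R : realType} {d : nat} (S : {set 'I_d * bool})
  (x : d.-tuple R) : R :=
  \prod_(l in S) literal_eval l x.

Definition subgroup_of {d : nat} (Pr : {set 'I_d}) (S : {set 'I_d * bool}) :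
  bool := [forall l in S, l.1 \in Pr].

Definition mexp {R : realType} {d : nat}
  (mu : {measure set (d.-tuple R) -> \bar R}) (f : d.-tuple R -> R) : R :=
  Rintegral mu setT f.

(* Maximum Subgroup Discrepancy; the sup over the finite family of subgroups
   is a max (the empty subgroup is always present, values are >= 0). *)
Definition MSD {R : realType} {d : nat}
  (mu nu : {measure set (d.-tuple R) -> \bar R}) (Pr : {set 'I_d}) : R :=
  \big[Num.max/0]_(S : {set 'I_d * bool} | subgroup_of Pr S)
     `| mexp mu (chi S) - mexp nu (chi S) |.

Definition dirac_seq {R : realType} {d : nat} (n : nat) (x : 'I_n -> d.-tuple R)
  : {measure set (d.-tuple R) -> \bar R}^nat :=
  fun k => match @insub _ (fun k => k < n)%N 'I_n k with
           | Some i => [the {measure set _ -> \bar R} of \d_(x i)]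
           | None => [the {measure set _ -> \bar R} of mzero]
           end.

Definition empirical {R : realType} {d : nat} (n : nat)
  (x : 'I_n -> d.-tuple R) : {measure set (d.-tuple R) -> \bar R} :=
  mscale ((n%:R : R)^-1)%:nng (msum (dirac_seq x) n).

Definition mutually_independent {dO dT : measure_display}
  {Om : measurableType dO} {T : measurableType dT} {R : realType}
  (P : probability Om R) {I : finType} (Y : I -> Om -> T) : Prop :=
  forall B : I -> set T, (forall i, measurable (B i)) ->
    P (\bigcap_(i in [set: I]) (Y i @^-1` B i)) =
    (\prod_(i : I) P (Y i @^-1` B i))%E.

Definition has_distribution {dO dT : measure_display}
  {Om : measurableType dO} {T : measurableType dT} {R : realType}
  (P : probability Om R) (Y : Om -> T) (mu : set T -> \bar R) : Prop :=
  measurable_fun setT Y /\ forall A, measurable A -> P (Y @^-1` A) = mu A.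

Definition join_samples {Om T : Type} {n1 n2 : nat}
  (X : 'I_n1 -> Om -> T) (X' : 'I_n2 -> Om -> T) : 'I_n1 + 'I_n2 -> Om -> T :=
  fun i => match i with inl i => X i | inr j => X' j end.

(* Main.v *)
(* On the support [X] each term [chi S] is the indicator of an event, so mu(chi S) is a
   probability p and its empirical counterpart a frequency of independent events. The
   pattern of which of the n events occur has a product Bernoulli law on {ffun 'I_n ->
   bool}; the Chernoff bound for this finite law, with E exp(t(b - p)) <= cosh t <= exp(t^2
   / 2), gives P(deviation > e) <= 2 exp(-n e^2 / 2). There are at most 4^|Pr| terms, and 4
   <= exp 2, so a union bound with e = 2 eps, where eps is the square root in the statement,
   costs delta per sample; the triangle inequality yields the 4 eps. This needs only exp(t^2
   / 2), not the sharp exp(t^2 / 8) of Hoeffding's lemma. *)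

Require Import Defs.
From HB Require Import structures.
From mathcomp Require Import all_boot all_order all_algebra.
From mathcomp Require Import all_classical all_reals all_analysis.
From mathcomp Require Import measurable_realfun.
From mathcomp Require Import ring lra.
Import Order.TTheory GRing.Theory Num.Theory.
Import numFieldNormedType.Exports.
Local Open Scope classical_set_scope.
Local Open Scope ring_scope.

(** * Sub-Gaussian moment bound for a centred Bernoulli variable *)

Lemma ger0_is_derive_homo (R : realType) (f df : R -> R) (a b : R) :
  (forall x : R, is_derive x 1 f (df x)) -> a <= b ->
  (forall x, a <= x -> 0 <= df x) -> f a <= f b.
Proof.
move=> fdf ab df0.
have cf : {within `[a, b], continuous f}.
  apply: continuous_subspaceT => x; apply: differentiable_continuous.
  by apply/derivable1_diffP; case: (fdf x).
have [c /itvP cab fE] := MVT_segment ab (fun x _ => fdf x) cf.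
by rewrite -subr_ge0 fE mulr_ge0 ?df0 ?subr_ge0 ?cab.
Qed.

(** By evenness take t >= 0. Then exp(-y^2/2) cosh y decreases from its value 1 at y = 0, because
    its derivative has the sign of sinh y - y cosh y. That tanh y <= y follows likewise: y cosh y -
    sinh y vanishes at 0 and has derivative y sinh y >= 0. *)
Lemma cosh_le_gauss (R : realType) (t : R) :
  (expR t + expR (- t)) / 2 <= expR (t ^+ 2 / 2).
Proof.
wlog t0 : t / 0 <= t => [H|].
  have [/H//|/ltW] := leP 0 t; rewrite -oppr_ge0 => /H.
  by rewrite opprK sqrrN addrC.
have sinh_ge0 (x : R) : 0 <= x -> 0 <= expR x - expR (- x).
  by move=> x0; rewrite subr_ge0 ler_expR; lra.
have tanh_le (x : R) : 0 <= x ->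
    expR x - expR (- x) <= x * (expR x + expR (- x)).
  move=> x0; rewrite -subr_ge0.
  pose k (y : R) := y * (expR y + expR (- y)) - (expR y - expR (- y)).
  rewrite (_ : 0 = k 0); last by rewrite /k oppr0 expR0; ring.
  rewrite -/(k x).
  apply: (@ger0_is_derive_homo _ k (fun y => y * (expR y - expR (- y)))) => //.
    by move=> y; apply: is_derive_eq; rewrite /GRing.scale /=; ring.
  by move=> y y0; rewrite mulr_ge0 ?sinh_ge0.
(* The sign turns a decreasing function into an increasing one, as [ger0_is_derive_homo]
   requires. *)
pose h (y : R) := - (expR (- (y ^+ 2 / 2)) * (expR y + expR (- y))).
have : h 0 <= h t.
  apply: (@ger0_is_derive_homo _ h (fun y => expR (- (y ^+ 2 / 2)) *
    (y * (expR y + expR (- y)) - (expR y - expR (- y))))) => //.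
    by move=> y; apply: is_derive_eq; rewrite /GRing.scale /=; field.
  by move=> y y0; rewrite mulr_ge0 ?expR_ge0 ?subr_ge0 ?tanh_le.
rewrite /h lerN2 oppr0 expr0n mul0r oppr0 expR0 mul1r expRN mulrC.
by rewrite ler_pdivrMr ?expR_gt0//; lra.
Qed.

(** Both centred values 1 - p and -p lie in [-1, 1], so each exponential lies below the chord of exp
    over [-t, t]. The mean is zero, so averaging cancels the sinh t part of the chord and leaves
    cosh t. *)
Lemma bernoulli_mgf_le (R : realType) (p t : R) : 0 <= p <= 1 ->
  p * expR (t * (1 - p)) + (1 - p) * expR (t * (0 - p)) <= expR (t ^+ 2 / 2).
Proof.
move=> /andP[p0 p1]; apply: le_trans (cosh_le_gauss _ t).
(* convexity of [expR] between [-t] and [t] *)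
have cvx (z : R) : -1 <= z <= 1 ->
    expR (t * z) <= (1 + z) / 2 * expR t + (1 - z) / 2 * expR (- t).
  move=> /andP[z1 z2].
  have z01 : Itv.spec (@Itv.num_sem R) (Itv.Real `[0%Z, 1%Z]) ((1 + z) / 2).
    by rewrite /Itv.spec /= /Itv.num_sem /= num_real in_itv/=; apply/andP; split; lra.
  have := convex_expR (Itv.mk z01) t (- t).
  rewrite !convRE /= /unstable.onem.
  rewrite [X in expR X <= _ -> _](_ : _ = t * z); last by field.
  by move/le_trans; apply; rewrite le_eqVlt; apply/orP; left; apply/eqP; field.
have h1 : -1 <= 1 - p <= 1 by apply/andP; split; lra.
have h2 : -1 <= 0 - p <= 1 by apply/andP; split; lra.
apply: le_trans (lerD (ler_wpM2l p0 (cvx _ h1)) (ler_wpM2l _ (cvx _ h2))) _.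
  by lra.
by rewrite le_eqVlt; apply/orP; left; apply/eqP; field.
Qed.

(** * Chernoff bound for the product Bernoulli law *)

Lemma bernoulli_tail_le (R : realType) (n : nat) (p e s : R) :
  0 <= p <= 1 -> 0 <= e -> s ^+ 2 = 1 ->
  \sum_(b : {ffun 'I_n -> bool} |
        n%:R * e < s * \sum_(i < n) ((b i)%:R - p))
     \prod_(i < n) (if b i then p else 1 - p) <= expR (- (n%:R * e ^+ 2 / 2)).
Proof.
(* Chernoff bound at parameter [s * e]; the sign [s] selects the tail *)
move=> p01 e0 s1; have /andP[p0 p1] := p01.
pose q (c : bool) := (if c then p else 1 - p) * expR (s * e * (c%:R - p)).
have q0 c : 0 <= q c.
  by rewrite mulr_ge0 ?expR_ge0//; case: c => //; rewrite subr_ge0.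
apply: (@le_trans _ _
  (expR (- (n%:R * e ^+ 2)) * \sum_(b : {ffun 'I_n -> bool}) \prod_(i < n) q (b i))).
  rewrite mulr_sumr big_mkcond/=; apply: ler_sum => b _.
  have w0 : 0 <= \prod_(i < n) (if b i then p else 1 - p).
    by apply: prodr_ge0 => i _; case: ifP; rewrite // subr_ge0.
  have -> : \prod_(i < n) q (b i) = (\prod_(i < n) (if b i then p else 1 - p)) *
      expR (e * (s * \sum_(i < n) ((b i)%:R - p))).
    by rewrite big_split/= -expR_sum mulrA (mulrC e) mulr_sumr.
  (* Markov's inequality term by term: on a deviating pattern the exponential factor is at least
     exp(n e^2), elsewhere the summand is only nonnegative. *)
  case: ifPn => [dev|_]; last by rewrite mulr_ge0 ?mulr_ge0 ?expR_ge0.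
  rewrite mulrCA ler_peMr// -expRD -{1}expR0 ler_expR expr2.
  rewrite -subr_gt0 in dev; have := mulr_ge0 e0 (ltW dev); lra.
(* Distributivity factors the sum over patterns into the n-th power of one moment generating
   function at s e; its bound exp(n e^2 / 2) takes back half of the exponent. *)
rewrite -(bigA_distr_bigA (fun _ c => q c)) prodr_const card_ord big_bool.
have -> : expR (- (n%:R * e ^+ 2 / 2)) =
    expR (- (n%:R * e ^+ 2)) * expR ((s * e) ^+ 2 / 2) ^+ n.
  by rewrite -expRM_natl -expRD exprMn s1; congr expR; field.
rewrite ler_wpM2l ?expR_ge0// lerXn2r ?nnegrE ?addr_ge0 ?expR_ge0//.
exact: bernoulli_mgf_le.
Qed.

(** * Concentration on the probability space *)

Lemma measure_bigsetU_le (d : measure_display) (T : measurableType d)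
  (R : realType) (mu : {measure set T -> \bar R}) (I : finType) (p : pred I)
  (F : I -> set T) : (forall i, measurable (F i)) ->
  (mu (\big[setU/set0]_(i | p i) F i) <= \sum_(i | p i) mu (F i))%E.
Proof.
(* The induction carries measurability of the partial unions, which binary subadditivity needs. *)
move=> mF; suff [] : measurable (\big[setU/set0]_(i | p i) F i) /\
  (mu (\big[setU/set0]_(i | p i) F i) <= \sum_(i | p i) mu (F i))%E by [].
elim/big_rec2 : _ => [|i s A _ [mA muA]]; first by rewrite measure0.
split; first exact: measurableU.
by apply: le_trans (measureU2 _ (mF i) mA) _; rewrite leeD2l.
Qed.

(** The bad event is a finite union of pattern events, so its probability reduces to a sum under the
    product Bernoulli law, split into the tails s = 1 and s = -1. *)
Lemma hoeffding_events (d : measure_display) (Om : measurableType d)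
  (R : realType) (P : probability Om R) (n : nat) (F : 'I_n -> set Om)
  (p e : R) :
  0 <= p <= 1 -> 0 <= e -> (forall i, measurable (F i)) ->
  (forall b : {ffun 'I_n -> bool},
     P (\bigcap_(i in [set: 'I_n]) (if b i then F i else ~` F i)) =
     (\prod_(i < n) (if b i then p else 1 - p))%:E) ->
  exists B, [/\ measurable B,
    (P B <= (2 * expR (- (n%:R * e ^+ 2 / 2)))%:E)%E &
    forall w, ~ B w -> `|\sum_(i < n) (\1_(F i) w - p)| <= n%:R * e].
Proof.
move=> p01 e0 mF PF; have /andP[p0 p1] := p01.
pose pat (b : {ffun 'I_n -> bool}) :=
  \bigcap_(i in [set: 'I_n]) (if b i then F i else ~` F i).
have mpat b : measurable (pat b).
  apply: fin_bigcap_measurable; first exact: finite_finset.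
  by move=> i _; case: ifP => _; [|apply: measurableC]; exact: mF.
pose dev (b : {ffun 'I_n -> bool}) := n%:R * e < `|\sum_(i < n) ((b i)%:R - p)|.
exists (\big[setU/set0]_(b | dev b) pat b); split.
- exact: bigsetU_measurable.
- apply: le_trans (measure_bigsetU_le _ _ _ P _ dev pat mpat) _.
  rewrite (eq_bigr _ (fun b _ => PF b)) sumEFin lee_fin.
  have tail s := bernoulli_tail_le R n p e s p01 e0.
  rewrite mulrDl mul1r.
  apply: le_trans (lerD (tail 1 _) (tail (-1) _)); rewrite ?sqrrN ?expr1n//.
  rewrite big_mkcond [X in _ <= X + _]big_mkcond [X in _ <= _ + X]big_mkcond.
  rewrite -big_split; apply: ler_sum => b _ /=.
  have w0 : 0 <= \prod_(i < n) (if b i then p else 1 - p).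
    by apply: prodr_ge0 => i _; case: ifP; rewrite // subr_ge0.
  rewrite /dev lter_normr !mul1r mulN1r.
  case: (_ < \sum_(_ < _) _); case: (_ < - _) => /=;
    by rewrite ?addr0 ?add0r// ?lerDl ?addr_ge0.
- move=> w Bw; rewrite leNgt; apply/negP => devw; apply: Bw.
  pose b := [ffun i => w \in F i].
  have bE i : \1_(F i) w = (b i)%:R :> R by rewrite indicE ffunE.
  rewrite (bigD1 b); last by rewrite /= /dev; under eq_bigr do rewrite -bE.
  left=> i _; rewrite ffunE; case: ifPn => [/set_mem//|].
  by rewrite notin_setE.
Qed.

Lemma hoeffding_sample (dO dT : measure_display) (Om : measurableType dO)
  (T : measurableType dT) (R : realType) (P : probability Om R)
  (mu : probability T R) (n : nat) (Y : 'I_n -> Om -> T) (E : set T) (e : R) :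
  (0 < n)%N -> (forall i, has_distribution P (Y i) mu) ->
  mutually_independent P Y -> measurable E -> 0 <= e ->
  exists B, [/\ measurable B,
    (P B <= (2 * expR (- (n%:R * e ^+ 2 / 2)))%:E)%E &
    forall w, ~ B w ->
      `|n%:R^-1 * \sum_(i < n) \1_E (Y i w) - fine (mu E)| <= e].
Proof.
move=> n0 Ymu indY mE e0.
have pE : (fine (mu E))%:E = mu E by rewrite fineK// fin_num_measure.
have p01 : 0 <= fine (mu E) <= 1.
  by rewrite -!lee_fin pE measure_ge0 probability_le1.
have mY i A : measurable A -> measurable (Y i @^-1` A).
  by move=> mA; rewrite -[X in measurable X]setTI; apply: (Ymu i).1.
have [i|b|B [mB PB Bdev]] :=
  hoeffding_events _ _ _ P n (fun i => Y i @^-1` E) (fine (mu E)) e p01 e0.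
- exact: mY.
(* Complements move inside the preimages, so that independence applies with each set equal to [E] or
   its complement. *)
- rewrite (_ : \bigcap_(i in _) _ = \bigcap_(i in [set: 'I_n])
      (Y i @^-1` (if b i then E else ~` E))); last first.
    by apply: eq_bigcapr => i _; case: (b i).
  rewrite indY; last by move=> i; case: (b i) => //; exact: measurableC.
  rewrite -prodEFin; apply: eq_bigr => i _.
  rewrite (Ymu i).2; last by case: (b i) => //; exact: measurableC.
  by case: (b i); rewrite ?probability_setC// ?EFinB pE.
- exists B; split=> // w /Bdev; rewrite sumrB sumr_const card_ord.
  rewrite -[fine _ *+ n]mulr_natl.
  have n0' : 0 < n%:R :> R by rewrite ltr0n.
  rewrite (_ : _ * _ - _ = n%:R^-1 *
    (\sum_(i < n) \1_(Y i @^-1` E) w - n%:R * fine (mu E))); last first.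
    by rewrite mulrBr mulKf ?gt_eqF//.
  by rewrite normrM gtr0_norm ?invr_gt0// ler_pdivrMl.
Qed.

(** * Independence within each sample *)

Lemma mutually_independent_inl (dO dT : measure_display)
  (Om : measurableType dO) (T : measurableType dT) (R : realType)
  (P : probability Om R) (n1 n2 : nat) (X : 'I_n1 -> Om -> T)
  (X' : 'I_n2 -> Om -> T) :
  mutually_independent P (join_samples X X') -> mutually_independent P X.
Proof.
move=> ind B mB.
(* Testing the other sample against the whole space contributes factors equal to one. *)
pose B' (k : 'I_n1 + 'I_n2) := match k with inl i => B i | inr _ => setT end.
have mB' k : measurable (B' k) by case: k => i /=; [exact: mB|].
have := ind B' mB'; rewrite big_sumType /= [X in (_ * X)%E]big1 ?mule1; last first.
  by move=> j _; rewrite preimage_setT probability_setT.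
move=> <-; congr (P _); apply/seteqP; split=> w /= Hw; last first.
  by move=> i _; exact: (Hw (inl i)).
by case=> i _ //; exact: Hw.
Qed.

Lemma mutually_independent_inr (dO dT : measure_display)
  (Om : measurableType dO) (T : measurableType dT) (R : realType)
  (P : probability Om R) (n1 n2 : nat) (X : 'I_n1 -> Om -> T)
  (X' : 'I_n2 -> Om -> T) :
  mutually_independent P (join_samples X X') -> mutually_independent P X'.
Proof.
move=> ind B mB.
pose B' (k : 'I_n1 + 'I_n2) := match k with inl _ => setT | inr i => B i end.
have mB' k : measurable (B' k) by case: k => i /=; [|exact: mB].
have := ind B' mB'; rewrite big_sumType /= [X in (X * _)%E]big1 ?mul1e; last first.
  by move=> j _; rewrite preimage_setT probability_setT.
move=> <-; congr (P _); apply/seteqP; split=> w /= Hw; last first.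
  by move=> i _; exact: (Hw (inr i)).
by case=> i _ //; exact: Hw.
Qed.

(** * Terms as indicators, and their number *)

Lemma measurable_chi (R : realType) (d : nat) (S : {set 'I_d * bool}) :
  measurable_fun [set: d.-tuple R] (@chi R d S).
Proof.
rewrite /chi; under eq_fun do rewrite -big_filter.
apply: measurable_prod => -[p []] _; rewrite /literal_eval /=.
  exact: measurable_tnth.
by apply: measurable_funB; [exact: measurable_cst|exact: measurable_tnth].
Qed.

Lemma measurable_chi1 (R : realType) (d : nat) (S : {set 'I_d * bool}) :
  measurable [set x : d.-tuple R | chi S x = 1].
Proof.
rewrite -[X in measurable X]setTI.
exact: (measurable_chi R d S measurableT [set 1] (measurable_set1 _)).
Qed.

Lemma chi_indic (R : realType) (d : nat) (Pr : {set 'I_d})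
  (S : {set 'I_d * bool}) (x : d.-tuple R) :
  subgroup_of Pr S -> (forall p, p \in Pr -> tnth x p = 0 \/ tnth x p = 1) ->
  chi S x = \1_[set y : d.-tuple R | chi S y = 1] x.
Proof.
move=> /forall_inP SPr xbin.
have [chi0|chi1] : chi S x = 0 \/ chi S x = 1.
  rewrite /chi; elim/big_ind : _ => [|a b|[p c] /SPr /= /xbin]; first by right.
    by case=> -> [] ->; rewrite ?mul0r ?mulr0 ?mulr1; [left|left|left|right].
  by case: c => /=; rewrite /literal_eval/= => -[] ->; rewrite ?subr0 ?subrr;
    [left|right|right|left].
- rewrite indicE memNset; first by rewrite chi0.
  by rewrite /= chi0 => /esym/eqP; rewrite oner_eq0.
- by rewrite indicE mem_set.
Qed.

(** Off [X] a term may take any real value, so it agrees with the indicator only almost everywhere.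
    Allowing any measure [m] covers both the true law and the empirical one. *)
Lemma mexp_chi (R : realType) (d : nat)
  (m : {measure set (d.-tuple R) -> \bar R}) (X : set (d.-tuple R))
  (Pr : {set 'I_d}) (S : {set 'I_d * bool}) :
  measurable X -> m (~` X) = 0%E ->
  (forall x, X x -> forall p, p \in Pr -> tnth x p = 0 \/ tnth x p = 1) ->
  subgroup_of Pr S ->
  mexp m (chi S) = fine (m [set x | chi S x = 1]).
Proof.
move=> mX mX0 Xbin SPr; rewrite /mexp /Rintegral; congr fine.
have mE := measurable_chi1 R d S.
rewrite -[in RHS](setIT [set x | _]) -integral_indic//.
apply: ae_eq_integral => //.
- by apply/measurable_EFinP; exact: measurable_chi.
- by apply/measurable_EFinP; exact: measurable_indic.
- exists (~` X); split=> //; first exact: measurableC.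
  move=> x /= + Xx; apply=> _; congr EFin.
  exact: (chi_indic _ _ _ _ _ SPr (Xbin x Xx)).
Qed.

Lemma empiricalE (R : realType) (d n : nat) (x : 'I_n -> d.-tuple R)
  (A : set (d.-tuple R)) :
  empirical x A = (n%:R^-1 * \sum_(i < n) \1_A (x i))%:E.
Proof.
rewrite /empirical /mscale /= /msum EFinM -sumEFin; congr (_ * _)%E.
(* Indices below [n] select the [Some] branch, so the default null measure never enters the sum. *)
by apply: eq_bigr => i _; rewrite /dirac_seq valK /= diracE indicE.
Qed.

(** Each subgroup is a subset of the 2 |Pr| literals; those containing a literal together with its
    negation are counted too. *)
Lemma card_subgroups_le (d : nat) (Pr : {set 'I_d}) :
  (#|[pred S | subgroup_of Pr S]| <= 4 ^ #|Pr|)%N.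
Proof.
rewrite (_ : 4 ^ _ = 2 ^ #|finset.setX Pr [set: bool]%SET|)%N; last first.
  by rewrite cardsX cardsT card_bool mulnC expnM.
rewrite -card_powerset; apply/subset_leq_card/fintype.subsetP => S.
rewrite !inE => /forall_inP SPr; apply/fintype.subsetP => l /SPr.
by rewrite !inE andbT.
Qed.

(** * Union bound over the subgroups and conclusion *)

Lemma uniform_deviation (R : realType) (d : nat)
  (mu : probability (d.-tuple R) R) (X : set (d.-tuple R)) (Pr : {set 'I_d})
  (dO : measure_display) (Om : measurableType dO) (P : probability Om R)
  (n : nat) (Y : 'I_n -> Om -> d.-tuple R) (e : R) :
  measurable X -> mu X = 1%E ->
  (forall x, X x -> forall p, p \in Pr -> tnth x p = 0 \/ tnth x p = 1) ->
  (0 < n)%N -> (forall i, has_distribution P (Y i) mu) ->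
  mutually_independent P Y -> 0 <= e ->
  exists B, [/\ measurable B,
    (P B <= (4 ^+ #|Pr| * (2 * expR (- (n%:R * e ^+ 2 / 2))))%:E)%E &
    forall w, ~ B w -> forall S, subgroup_of Pr S ->
      `|mexp (empirical (fun i => Y i w)) (chi S) - mexp mu (chi S)| <= e].
Proof.
move=> mX muX Xbin n0 Ymu indY e0.
set c := 2 * _.
have muX0 : mu (~` X) = 0%E by rewrite probability_setC// muX subee.
have [Bdev Bdev_spec] := boolp.choice (fun S =>
  hoeffding_sample _ _ _ _ R P mu n Y _ e n0 Ymu indY (measurable_chi1 R d S) e0).
pose out i := Y i @^-1` (~` X).
have mout i : measurable (out i).
  rewrite -[X in measurable X]setTI; apply: (Ymu i).1 => //.
  exact: measurableC.
(* The null event that some sample point leaves [X] must be discarded: [mexp_chi] applies to the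
   empirical measure only when that measure is carried by [X]. *)
pose B1 := \big[setU/set0]_(i < n) out i.
pose B2 := \big[setU/set0]_(S | subgroup_of Pr S) Bdev S.
have mdev S : measurable (Bdev S) by have [] := Bdev_spec S.
have mB1 : measurable B1 by exact: bigsetU_measurable.
have mB2 : measurable B2 by exact: bigsetU_measurable.
have PB1 : P B1 = 0%E.
  apply/eqP; rewrite eq_le measure_ge0 andbT.
  apply: le_trans (measure_bigsetU_le _ _ _ P _ _ _ mout) _.
  rewrite big1// => i _; rewrite -[RHS]muX0; apply: (Ymu i).2.
  exact: measurableC.
exists (B1 `|` B2); split; first exact: measurableU.
- have : (P (B1 `|` B2) <= P B1 + P B2)%E by exact: measureU2.
  rewrite PB1 add0e => /le_trans; apply.
  apply: le_trans (measure_bigsetU_le _ _ _ P _ _ _ mdev) _.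
  apply: (@le_trans _ _ (\sum_(S | subgroup_of Pr S) c%:E)%E).
    by apply: lee_sum => S _; have [] := Bdev_spec S.
  rewrite sumEFin lee_fin sumr_const -[_ *+ #|_|]mulr_natl -natrX ler_wpM2r//.
    by rewrite mulr_ge0// expR_ge0.
  by rewrite ler_nat card_subgroups_le.
- move=> w /not_orP[B1w B2w] S SPr.
  have YX i : X (Y i w).
    by apply: contrapT => nX; apply: B1w; rewrite /B1 (bigD1 i)//=; left.
  have [_ _ /(_ w)] := Bdev_spec S.
  rewrite (mexp_chi _ _ _ _ _ _ mX muX0 Xbin SPr).
  rewrite (mexp_chi _ _ _ _ _ _ mX _ Xbin SPr) ?empiricalE//=; last first.
    by rewrite big1 ?mulr0// => i _; rewrite indicE memNset//; exact.
  by apply=> BS; apply: B2w; rewrite /B2 (bigD1 S)//=; left.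
Qed.

Theorem theorem3p1 (R : realType) (d : nat)
  (mu nu : probability (d.-tuple R) R)
  (X : set (d.-tuple R)) (Pr : {set 'I_d})
  (mX : measurable X) (muX : mu X = 1%E) (nuX : nu X = 1%E)
  (Xbin : forall x, X x -> forall p, p \in Pr ->
            tnth x p = 0 \/ tnth x p = 1)
  (dO : measure_display) (Om : measurableType dO) (P : probability Om R)
  (N1 N2 : nat) (N1pos : (0 < N1)%N) (N2pos : (0 < N2)%N)
  (Xs : 'I_N1 -> Om -> d.-tuple R) (Xs' : 'I_N2 -> Om -> d.-tuple R)
  (Xs_mu : forall i, has_distribution P (Xs i) mu)
  (Xs'_nu : forall j, has_distribution P (Xs' j) nu)
  (indep : mutually_independent P (join_samples Xs Xs'))
  (delta : R) (delta_pos : 0 < delta) :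
  let N := minn N1 N2 in
  exists A : set Om, measurable A /\ ((1 - 2 * delta)%:E <= P A)%E /\
    forall w, A w ->
      MSD mu nu Pr <=
      MSD (empirical (fun i => Xs i w)) (empirical (fun j => Xs' j w)) Pr
      + 4 * Num.sqrt ((2 * #|Pr|%:R + ln (2 / delta)) / (2 * N%:R)).
Proof.
move=> N.
(* For delta > 1 the required probability is negative and the empty event suffices. Otherwise ln(2 /
   delta) >= 0, so the radicand is nonnegative and squaring [eps] recovers it. *)
have [d1|d1] := ltP 1 delta.
  exists set0; split; first exact: measurable0.
  by split=> //; rewrite measure0 lee_fin; lra.
set L := 2 * #|Pr|%:R + _; set eps := Num.sqrt _.
have N0 : (0 < N)%N by rewrite leq_min N1pos.
have L0 : 0 <= L.
  by rewrite addr_ge0 ?mulr_ge0// ln_ge0// ler_pdivlMr//; lra.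
have eps0 : 0 <= eps := sqrtr_ge0 _.
have eps2 : eps ^+ 2 = L / (2 * N%:R) by rewrite sqr_sqrtr// divr_ge0.
have e0 : 0 <= 2 * eps by rewrite mulr_ge0.
(* each tail is at most [exp (- L) = (delta / 2) exp (- 2 |Pr|)], and [4 <= exp 2] *)
have tail n : (N <= n)%N ->
    4 ^+ #|Pr| * (2 * expR (- (n%:R * (2 * eps) ^+ 2 / 2))) <= delta.
  move=> Nn; have N0' : 0 < N%:R :> R by rewrite ltr0n.
  have expL : expR (- (n%:R * (2 * eps) ^+ 2 / 2)) <= expR (- L).
    rewrite ler_expR lerN2 exprMn eps2.
    (* The factor n / N is at least 1, and L >= 0, so the larger sample only improves the bound. *)
    rewrite (_ : _ / 2 = L * (n%:R / N%:R)); last by field; rewrite gt_eqF.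
    by rewrite ler_peMr// ler_pdivlMr// mul1r ler_nat.
  apply: (@le_trans _ _ (4 ^+ #|Pr| * (2 * expR (- L)))).
    by rewrite ler_wpM2l ?exprn_ge0// ler_wpM2l.
  have -> : expR (- L) = expR (- 2) ^+ #|Pr| * (delta / 2).
    rewrite /L opprD expRD [expR (- ln _)]expRN lnK ?posrE ?divr_gt0// invf_div.
    by rewrite -expRM_natr mulNr.
  rewrite [leLHS](_ : _ = (4 * expR (- 2)) ^+ #|Pr| * delta); last first.
    by rewrite exprMn; field.
  rewrite ler_piMl ?(ltW delta_pos)// exprn_ile1 ?mulr_ge0 ?expR_ge0//.
  rewrite expRN ler_pdivrMr ?expR_gt0// mul1r.
  (* Squaring exp 1 >= 2 gives exp 2 >= 4. *)
  have e1 := expR_ge1Dx (1 : R).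
  by rewrite (_ : 2 = 1 + 1 :> R)// expRD; nra.
have [B [mB PB Bdev]] := uniform_deviation _ _ _ _ _ _ _ _ _ _ _ mX muX Xbin
  N1pos Xs_mu (mutually_independent_inl _ _ _ _ _ _ _ _ _ _ indep) e0.
have [B' [mB' PB' Bdev']] := uniform_deviation _ _ _ _ _ _ _ _ _ _ _ mX nuX Xbin
  N2pos Xs'_nu (mutually_independent_inr _ _ _ _ _ _ _ _ _ _ indep) e0.
have mBB' : measurable (B `|` B') by exact: measurableU.
exists (~` (B `|` B')); split; first exact: measurableC.
split.
  rewrite probability_setC// EFinB leeB// (_ : 2 * delta = delta + delta).
    rewrite EFinD; apply: le_trans (measureU2 _ mB mB') (leeD _ _).
      by apply: le_trans PB _; rewrite lee_fin tail// geq_minl.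
    by apply: le_trans PB' _; rewrite lee_fin tail// geq_minr.
  by ring.
(* The maximum starts from 0, hence the separate nonnegativity goal. *)
move=> w /not_orP[Bw Bw']; apply: bigmax_le => [|S SPr].
  by rewrite addr_ge0 ?bigmax_ge_id// mulr_ge0.
have h1 := Bdev w Bw S SPr; have h2 := Bdev' w Bw' S SPr.
have h3 : `|mexp (empirical (fun i => Xs i w)) (chi S) -
    mexp (empirical (fun j => Xs' j w)) (chi S)| <=
    MSD (empirical (fun i => Xs i w)) (empirical (fun j => Xs' j w)) Pr.
  exact: (le_bigmax_cond _ (fun S => `|mexp _ (chi S) - mexp _ (chi S)|) SPr).
move: h1 h2 h3; rewrite !ler_norml => /andP[? ?] /andP[? ?] /andP[? ?].
by apply/andP; split; lra.
Qed.
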